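(* Let $n\ge1$ and let $G$ be a graph with distinct vertex labels in $[n]$. Then $Y_G$ is $e$-positive if and only if $G$ is a disjoint union of complete graphs. Moreover, $Y_G$ is never $e$-negative.
   Context: All graphs are finite and simple. A graph $G$ with distinct vertex labels in $[n]=\{1,\dots,n\}$ is a graph with $n$ vertices labelled bijectively by $1,\dots,n$; write $v_i$ for the vertex labelled $i$. Let $x_1,x_2,\dots$ be noncommuting variables. A proper colouring of $G$ is a map $\kappa$ from the vertices to $\{1,2,\dots\}$ with $\kappa(u)\ne\kappa(v)$ whenever $u,v$ are adjacent. The chromatic symmetric function in noncommuting variables is $Y_G=\sum_\kappa x_{\kappa(v_1)}\cdots x_{\kappa(v_n)}\in\mathbb{Q}\langle\langle x_1,x_2,\dots\rangle\rangle$, summed over all proper colourings $\kappa$ of $G$. For a set partition $\pi\vdash[n]$ (a family of disjoint nonempty blocks with union $[n]$) define (sums over tuples of positive integers): $m_\pi=\sum x_{i_1}\cdots x_{i_n}$ over tuples with $i_j=i_k$ if and only if $j,k$ are in the same block of $\pi$; and $e_\pi=\sum x_{i_1}\cdots x_{i_n}$ over tuples with $i_j\neq i_k$ whenever $j\ne k$ are in the same block of $\pi$. For $n\ge1$, $\mathrm{NCSym}^n=\mathrm{span}_{\mathbb{Q}}\{m_\pi:\pi\vdash[n]\}$; the set $\{e_\pi:\pi\vdash[n]\}$ is a basis of it, and $Y_G\in\mathrm{NCSym}^n$. An element $f=\sum_\pi c_\pi e_\pi$ is $e$-positive if $c_\pi\ge0$ for all $\pi$, and $e$-negative if $c_\pi\le0$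 for all $\pi$. *)

(* Defs.v *)
From HB Require Import structures.
From mathcomp Require Import all_boot all_order all_algebra.
From mathcomp Require Import classical_sets fsbigop.

Set Implicit Arguments.
Unset Strict Implicit.
Unset Printing Implicit Defensive.

Import Order.TTheory GRing.Theory Num.Theory.
Local Open Scope classical_set_scope.
Local Open Scope ring_scope.

Record sgraph := SGraph {
  vertex :> finType;
  edge : rel vertex;
  edge_sym : symmetric edge;
  edge_irr : irreflexive edge }.

Arguments edge {s}.

Definition proper_colouring (G : sgraph) (kappa : {ffun G -> nat}) : Prop :=
  forall u w : G, edge u w -> kappa u <> kappa w.

(* [G] is the disjoint union of the complete graphs on the blocks of [P]. *)
Definition disjoint_union_complete (G : sgraph) : Prop :=
  exists P : {set {set G}}, finset.partition P [set: G]%SET /\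
    forall u w : G, edge u w <->
      u <> w /\ exists B : {set G}, [/\ B \in P, u \in B & w \in B].

(* Formal power series over the rationals in noncommuting variables, given by
   their coefficient at each word; the letter [i : nat] stands for the variable
   x_{i+1}. *)
Definition ncseries := seq nat -> rat.

Definition ncmonomial (u : seq nat) : ncseries := fun w => (w == u)%:R.

(* The formal sum of the monomials [word t] for [t] in [A]. The coefficient at
   [w] is a finitely supported sum, hence meaningful when [word] takes each
   value finitely often on [A]; below, [word] is injective (for [chromatic_nc],
   because the labelling [v] is onto). *)
Definition ncsum (T : choiceType) (A : set T) (word : T -> seq nat) : ncseries :=
  fun w => \sum_(t \in A) ncmonomial (word t) w.

(* [v i] is the vertex with label [i], the labels being 0, ..., n-1. *)
Definition chromatic_nc (n : nat) (G : sgraph) (v : 'I_n -> G) : ncseries :=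
  ncsum [set kappa : {ffun G -> nat} | proper_colouring kappa]
        (fun kappa => [tuple kappa (v i) | i < n]).

Definition elem_nc (n : nat) (pi : {set {set 'I_n}}) : ncseries :=
  ncsum [set t : n.-tuple nat |
          forall (B : {set 'I_n}) (j k : 'I_n),
            B \in pi -> j \in B -> k \in B -> j <> k -> tnth t j <> tnth t k]
        (fun t => t).

Definition e_expansion (n : nat) (f : ncseries)
    (c : {set {set 'I_n}} -> rat) : Prop :=
  forall w : seq nat,
    f w = \sum_(pi : {set {set 'I_n}} | finset.partition pi [set: 'I_n]%SET)
            c pi * elem_nc pi w.

(* The coefficients of an e-expansion are unique, the elementary functions
   indexed by the set partitions of [n] being linearly independent. *)
Definition e_positive (n : nat) (f : ncseries) : Prop :=
  exists c : {set {set 'I_n}} -> rat, e_expansion f c /\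
    forall pi, finset.partition pi [set: 'I_n]%SET -> 0 <= c pi.

Definition e_negative (n : nat) (f : ncseries) : Prop :=
  exists c : {set {set 'I_n}} -> rat, e_expansion f c /\
    forall pi, finset.partition pi [set: 'I_n]%SET -> c pi <= 0.

(* Main.v *)
(**
Reading off the coefficient of a word with equality pattern tau turns an
expansion Y_G = sum_pi c_pi e_pi into
  [tau is stable in G] = sum of c_pi over the pi meeting every block of tau at
  most once.
For tau discrete this gives sum_pi c_pi = 1, so the c_pi cannot all be
nonpositive. For tau with the single nontrivial block {i, j} it gives that the
c_pi with i, j in different blocks add up to 0 if ij is an edge, and to 1 if it
is not. When all c_pi are nonnegative, any pi with c_pi <> 0 therefore has i, j
in one block if and only if ij is an edge. Conversely, Y_G = e_pi when G is the
disjoint union of the complete graphs on the blocks of pi.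
*)

Require Import Defs.
From mathcomp Require Import boolp classical_sets fsbigop.
From mathcomp Require Import all_boot all_order all_algebra.

Set Implicit Arguments.
Unset Strict Implicit.
Unset Printing Implicit Defensive.

Import Order.TTheory GRing.Theory Num.Theory.
Local Open Scope ring_scope.

Lemma ncsum_notin (T : choiceType) (A : set T) (word : T -> seq nat) w :
  (forall t, A t -> word t <> w) -> ncsum A word w = 0.
Proof.
move=> wordNw; apply: fsbig1 => t At; rewrite /ncmonomial.
by case: eqP => // /esym /(wordNw _ At).
Qed.

Lemma ncsum_in (T : choiceType) (A : set T) (word : T -> seq nat) t :
  injective word -> A t -> ncsum A word (word t) = 1.
Proof.
move=> word_inj At; rewrite /ncsum -(fsbig_widen [set t]%classic) ?fsbig_set1.
- by rewrite /ncmonomial eqxx.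
- by move=> _ ->.
- move=> s [_ /= sNt]; rewrite /preimage /= /ncmonomial.
  by case: eqP => // /word_inj /esym /sNt.
Qed.

Lemma partition_same_block (T : finType) (P : {set {set T}}) (x y : T) :
  partition P [set: T]%SET ->
  (exists B : {set T}, [/\ B \in P, x \in B & y \in B]) <->
  pblock P x = pblock P y.
Proof.
case/and3P=> /eqP covP trivP _; split=> [[B [PB xB yB]]|eqxy].
  by rewrite !(def_pblock trivP PB).
exists (pblock P x).
by rewrite {3}eqxy !mem_pblock pblock_mem covP ?inE.
Qed.

Lemma preim_partition_same_block (T : finType) (rT : eqType) (f : T -> rT)
    (x y : T) :
  (exists B : {set T}, [/\ B \in preim_partition f [set: T]%SET,
                           x \in B & y \in B]) <-> f x = f y.
Proof.
have eqvf : {in [set: T]%SET & &, equivalence_rel [rel x y | f x == f y]}.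
  by split=> //= /eqP->.
have /and3P[/eqP covP trivP _] := preim_partitionP f [set: T]%SET.
split=> [[B [PB xB yB]]|eqxy].
  have := pblock_equivalence_partition eqvf (in_setT x) (in_setT y).
  by rewrite (def_pblock trivP PB xB) yB => /esym /eqP.
exists (pblock (preim_partition f [set: T]%SET) x).
rewrite pblock_mem ?covP ?inE // mem_pblock covP inE.
by rewrite pblock_equivalence_partition ?inE //= eqxy.
Qed.

(** Trades the partition for a classifying map: unlike a family of blocks, a map passes between
    vertices and labels by composition with [v] or its inverse. *)
Lemma disjoint_union_completeP (G : sgraph) :
  disjoint_union_complete G <->
  exists (rT : eqType) (f : G -> rT),
    forall u w : G, edge u w <-> u <> w /\ f u = f w.
Proof.
split=> [[P [partP edgeE]]|[rT [f edgeE]]].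
  exists {set G}, (pblock P) => u w.
  by rewrite edgeE (partition_same_block _ _ partP).
exists (preim_partition f [set: G]%SET); split; first exact: preim_partitionP.
by move=> u w; rewrite edgeE preim_partition_same_block.
Qed.

(** As [v] is bijective, exactly one map on the vertices spells [t], so the coefficient is 1 or 0
    according to whether that map is proper. *)
Lemma chromatic_ncE (n : nat) (G : sgraph) (v : 'I_n -> G) (t : n.-tuple nat) :
  bijective v ->
  chromatic_nc v t =
    `[< forall i j, edge (v i) (v j) -> tnth t i <> tnth t j >]%:R.
Proof.
move=> [v' vK v'K].
pose word (kappa : {ffun G -> nat}) : seq nat := [tuple kappa (v i) | i < n].
rewrite /chromatic_nc -/word.
have wordP (kappa : {ffun G -> nat}) : word kappa = t <->
    kappa = [ffun u => tnth t (v' u)].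
  split=> [/val_inj <-|->].
    by apply/ffunP=> u; rewrite ffunE tnth_mktuple v'K.
  by congr val; apply: eq_from_tnth => i; rewrite tnth_mktuple ffunE vK.
case: asboolP => [tP|tNP].
  rewrite -(iffRL (wordP _) erefl); apply: ncsum_in.
    move=> k1 k2 /val_inj eqk; apply/ffunP=> u.
    have := congr1 (fun s => tnth s (v' u)) eqk.
    by rewrite !tnth_mktuple v'K.
  by move=> u w uw; rewrite !ffunE; apply: tP; rewrite !v'K.
apply: ncsum_notin => kappa kP /wordP kE; apply: tNP => i j /kP.
by rewrite kE !ffunE !vK.
Qed.

Lemma elem_ncE (n : nat) (pi : {set {set 'I_n}}) (t : n.-tuple nat) :
  partition pi [set: 'I_n]%SET ->
  elem_nc pi t =
    `[< forall i j, i <> j -> pblock pi i = pblock pi j ->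
          tnth t i <> tnth t j >]%:R.
Proof.
move=> pi_part; case: asboolP => [tP|tNP].
  apply: (ncsum_in val_inj) => B i j piB iB jB ij.
  by apply: tP => //; apply/partition_same_block => //; exists B.
apply: ncsum_notin => s sP /val_inj eqst; apply: tNP => i j ij.
case/(partition_same_block _ _ pi_part) => B [piB iB jB].
by rewrite -eqst; apply: (sP B).
Qed.

Lemma chromatic_nc_elem_nc (n : nat) (G : sgraph) (v : 'I_n -> G)
    (pi : {set {set 'I_n}}) :
  bijective v -> partition pi [set: 'I_n]%SET ->
  (forall i j, edge (v i) (v j) <-> i <> j /\ pblock pi i = pblock pi j) ->
  chromatic_nc v =1 elem_nc pi.
Proof.
move=> v_bij pi_part edgeE w.
have [/eqP sz_w|sz_w] := eqVneq (size w) n.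
  rewrite -[w]/(val (Tuple sz_w)) chromatic_ncE // elem_ncE //.
  congr (nat_of_bool _)%:R; apply: asbool_equiv_eq.
  split=> tP i j; first by move=> ij eqij; apply: tP; apply/edgeE.
  by case/edgeE; apply: tP.
(* Both series are homogeneous of degree [n], so words of any other length have coefficient 0. *)
by rewrite /chromatic_nc /elem_nc !ncsum_notin // => [t|kappa] _ eqw;
   move: sz_w; rewrite -eqw size_tuple eqxx.
Qed.

Section Expansion.

Variables (n : nat) (G : sgraph) (v : 'I_n -> G).
Variable c : {set {set 'I_n}} -> rat.
Hypotheses (v_bij : bijective v) (cE : e_expansion (chromatic_nc v) c).

Lemma e_expansion_sum :
  \sum_(pi : {set {set 'I_n}} | partition pi [set: 'I_n]%SET) c pi = 1.
Proof.
(* A word without repeated letters occurs in [chromatic_nc v] and in every [elem_nc pi]. *)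
pose t := [tuple (i : nat) | i < n].
have t_inj (i j : 'I_n) : tnth t i = tnth t j -> i = j.
  by rewrite !tnth_mktuple => /val_inj.
have := cE t; rewrite chromatic_ncE // asboolT => [eqt|i j ij /t_inj eqij].
  rewrite -[RHS]/(true%:R) eqt.
  apply: eq_bigr => pi pi_part; rewrite elem_ncE // asboolT ?mulr1 //.
  by move=> i j ij _ /t_inj.
by rewrite eqij edge_irr in ij.
Qed.

Lemma e_expansion_separating (i j : 'I_n) : i <> j ->
  \sum_(pi : {set {set 'I_n}} | partition pi [set: 'I_n]%SET)
     c pi * (pblock pi i != pblock pi j)%:R = (~~ edge (v i) (v j))%:R.
Proof.
(* The only coincidence of letters in [t] is between positions [i] and [j]. Hence [t_sep], applied
   below both to adjacency and to lying in a common block. *)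
move=> neij; pose t := [tuple val (if k == j then i else k) | k < n].
have t_sep (r : rel 'I_n) : symmetric r ->
    `[< forall a b, a <> b -> r a b -> tnth t a <> tnth t b >] = ~~ r i j.
  move=> r_sym; apply/asboolP/idP => [tP|rij a b neab rab].
    apply/negP => rij; apply: (tP i j) => //.
    by rewrite !tnth_mktuple eqxx; case: eqP.
  rewrite !tnth_mktuple; case: (eqVneq a j) (eqVneq b j) => [aj|aj] [bj|bj].
  - by case: neab; rewrite aj bj.
  - by move=> /val_inj ib; move: rij; rewrite r_sym -aj ib rab.
  - by move=> /val_inj ai; move: rij; rewrite -bj -ai rab.
  - by move=> /val_inj.
have := cE t; rewrite chromatic_ncE //.
rewrite -(t_sep (fun a b => edge (v a) (v b))) => [eqt|a b]; last first.
  exact: edge_sym.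
(* Properness carries no condition [a <> b]; irreflexivity of [edge] supplies it. *)
transitivity (`[< forall a b, edge (v a) (v b) ->
                    tnth t a <> tnth t b >]%:R : rat); last first.
  congr (nat_of_bool _)%:R; apply: asbool_equiv_eq.
  split=> tP a b; first by move=> _; apply: tP.
  by move=> ab; apply: tP => // eqab; rewrite eqab edge_irr in ab.
rewrite eqt; apply: eq_bigr => pi pi_part; congr (_ * _).
rewrite elem_ncE // -(t_sep (fun a b => pblock pi a == pblock pi b)) => [|a b].
  congr (nat_of_bool _)%:R; apply: asbool_equiv_eq.
  by split=> tP a b ab /eqP; apply: tP.
exact: eq_sym.
Qed.

Hypothesis c_ge0 : forall pi, partition pi [set: 'I_n]%SET -> 0 <= c pi.

Lemma e_expansion_support (pi : {set {set 'I_n}}) (i j : 'I_n) :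
  partition pi [set: 'I_n]%SET -> c pi != 0 -> i <> j ->
  edge (v i) (v j) = (pblock pi i == pblock pi j).
Proof.
move=> pi_part cpi_neq0 neij; have sepE := e_expansion_separating neij.
have [ij|nij] := boolP (edge (v i) (v j)).
  move: sepE; rewrite ij /= => /psumr_eq0P sep0.
  have /eqP := sep0 (fun rho rho_part => mulr_ge0 (c_ge0 rho_part) (ler0n _ _))
    _ pi_part.
  by rewrite mulf_eq0 (negPf cpi_neq0) pnatr_eq0 eqb0 negbK /= => ->.
(* The partitions separating [i] and [j] already account for the whole total 1, so those joining
   them contribute 0, and nonnegativity kills each term. *)
have : \sum_(rho : {set {set 'I_n}} | partition rho [set: 'I_n]%SET)
    c rho * (pblock rho i == pblock rho j)%:R = 0.
  rewrite (negPf nij) in sepE.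
  apply: (addIr 1); rewrite add0r -[X in _ + X = _]sepE -big_split.
  rewrite -[RHS]e_expansion_sum /=; apply: eq_bigr => rho _.
  by case: eqP => _; rewrite !(mulr1, mulr0) (addr0, add0r).
move=> /psumr_eq0P sep0.
have /eqP := sep0 (fun rho rho_part => mulr_ge0 (c_ge0 rho_part) (ler0n _ _))
  _ pi_part.
by rewrite mulf_eq0 (negPf cpi_neq0) pnatr_eq0 eqb0 /= => /negPf ->.
Qed.

End Expansion.

Theorem theorem4p14 (n : nat) (hn : (0 < n)%N) (G : sgraph)
    (v : 'I_n -> G) (hv : bijective v) :
  (e_positive n (chromatic_nc v) <-> disjoint_union_complete G)
  /\ ~ e_negative n (chromatic_nc v).
Proof.
have [v' vK v'K] := hv.
split; [split=> [[c [cE c_ge0]]|]|case=> c [cE c_le0]].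
- have [pi /andP[pi_part cpi_neq0]] : exists pi : {set {set 'I_n}},
      partition pi [set: 'I_n]%SET && (c pi != 0).
    apply/existsP; apply: contraPT (e_expansion_sum hv cE) => /existsPn c0.
    rewrite big1 => [|pi pi_part]; first by move/eqP; rewrite eq_sym oner_eq0.
    by have := c0 pi; rewrite pi_part negbK => /eqP.
  apply/disjoint_union_completeP; exists {set 'I_n}, (pblock pi \o v') => u w.
  (* On the diagonal both sides are false; [e_expansion_support] handles only distinct labels. *)
  have [->|/eqP neuw] := eqVneq u w; first by rewrite edge_irr; split=> // -[].
  rewrite -{1}(v'K u) -{1}(v'K w).
  rewrite (e_expansion_support hv cE c_ge0 pi_part cpi_neq0).
    by split=> [/eqP|[_ /eqP]].
  by move=> /(can_inj v'K).
- case/disjoint_union_completeP => rT [f edgeE].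
  (* The components of [G], read on labels; the expansion is the single term [elem_nc pi]. *)
  pose pi := preim_partition (f \o v) [set: 'I_n]%SET.
  have pi_part : partition pi [set: 'I_n]%SET by exact: preim_partitionP.
  exists (fun rho => (rho == pi)%:R); split=> [w|rho _]; last exact: ler0n.
  rewrite (bigD1 pi) //= eqxx mul1r big1 => [|rho /andP[_ /negPf->]].
    rewrite addr0; apply: chromatic_nc_elem_nc => // i j.
    rewrite edgeE -(partition_same_block _ _ pi_part).
    rewrite preim_partition_same_block /=.
    by split=> -[neij fij]; split=> // eqij; apply: neij;
       [rewrite eqij | apply: (can_inj vK)].
  by rewrite mul0r.
- have : \sum_(pi : {set {set 'I_n}} | partition pi [set: 'I_n]%SET)
      c pi <= 0 by apply: sumr_le0.
  by rewrite (e_expansion_sum hv cE) ler10.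
Qed.
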